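(* Let $a,b$ be integers with $1\leq b\leq a$. Then the full count matroid $\mathcal{M}(a,b)$ (on the edge set of $K_n^{a,b}$, for any positive integer $n$) has the $k$-fold circuit property for all $k\geq 1$.
   Context: For integers $a,b$ with $0\leq b<2a$ and a multigraph $H=(V,E)$ (loops allowed), the count matroid $\mathcal{M}_{a,b}(H)$ is the matroid on $E$ in which $F\subseteq E$ is independent iff $|F'|\leq a|V(F')|-b$ for every nonempty $F'\subseteq F$, where $V(F')$ is the set of vertices incident to edges of $F'$. $K_n^{a,b}$ is the multigraph on $n$ vertices in which each vertex has $\max\{a-b,0\}$ loops and each pair of distinct vertices is joined by $2a-b$ parallel edges; the full count matroid is $\mathcal{M}(a,b)=\mathcal{M}_{a,b}(K_n^{a,b})$. For a matroid $(E,r)$ with closure $\mathrm{cl}(X)=\{x:r(X+x)=r(X)\}$: a cyclic set is a set $D$ with $r(D-e)=r(D)$ for all $e\in D$; a $k$-fold circuit is a cyclic set with $r(D)=|D|-k$; its principal partition is $\{D\setminus B: B\subseteq D\text{ a }(k-1)\text{-fold circuit}\}$ (a partition of $D$). A $k$-fold circuit $D$ with principal partition $\{A_1,\dots,A_\ell\}$ is balanced if $r(\bigcap_{i=1}^\ell\mathrm{cl}(D\setminus A_i))=\ell-k$, and the matroid has the $k$-fold circuit property if all its $k$-fold circuits are balanced. *)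

(* Defs.v *)
From HB Require Import structures.
From mathcomp Require Import all_boot.

Set Implicit Arguments.
Unset Strict Implicit.
Unset Printing Implicit Defensive.

Record matroid (E : finType) := Matroid {
  indep : pred {set E};
  indep0 : indep set0;
  indepS : forall I J : {set E}, I \subset J -> indep J -> indep I;
  indep_aug : forall I J : {set E}, indep I -> indep J -> #|I| < #|J| ->
    exists2 e, e \in J :\: I & indep (e |: I)
}.

Section MatroidTheory.
Variables (E : finType) (M : matroid E).
Implicit Types (B D X : {set E}) (k : nat).

Definition rank X : nat := \max_(I : {set E} | (I \subset X) && indep M I) #|I|.

Definition cl X : {set E} := [set x | rank (x |: X) == rank X].

Definition cyclic_set D : bool := [forall e in D, rank (D :\ e) == rank D].

(* r(D) = |D| - k as integers, written without subtraction. *)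
Definition kfold_circuit k D : bool := cyclic_set D && (rank D + k == #|D|).

(* Meaningful for k > 0 only, because of the truncated predecessor. *)
Definition principal_partition k D : {set {set E}} :=
  [set D :\: B | B : {set E} & (B \subset D) && kfold_circuit k.-1 B].

(* The rank of the intersection equals l - k as an integer, where l is the
   number of parts. *)
Definition balanced k D : Prop :=
  rank (\bigcap_(A in principal_partition k D) cl (D :\: A)) + k
  = #|principal_partition k D|.

Definition kfold_circuit_property k : Prop :=
  forall D, kfold_circuit k D -> balanced k D.

End MatroidTheory.

(* An edge is a loop when it has exactly one end; parallel edges are distinct
   elements of [edge] with the same ends. *)
Record multigraph := Multigraph {
  vertex : finType;
  edge : finType;
  ends : edge -> {set vertex};
  card_ends : forall e, 0 < #|ends e| <= 2
}.

Section CountMatroid.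
Variables (a b : nat) (H : multigraph).
Implicit Types (F I J T : {set edge H}).

Definition vertices_of F : {set vertex H} := \bigcup_(e in F) ends e.

(* |F'| <= a |V(F')| - b as integers, written without subtraction. *)
Definition count_indep F : bool :=
  [forall F' : {set edge H}, (F' \subset F) && (F' != set0) ==>
     (#|F'| + b <= a * #|vertices_of F'|)].

Lemma count_indepP F :
  reflect (forall F', F' \subset F -> F' != set0 ->
             #|F'| + b <= a * #|vertices_of F'|)
          (count_indep F).
Proof.
apply: (iffP forallP) => [h F' s n | h F']; first by move: (h F'); rewrite s n.
by apply/implyP => /andP[s n]; apply: h.
Qed.

Lemma vertices_ofS F F' : F \subset F' -> vertices_of F \subset vertices_of F'.
Proof.
move=> s; apply/bigcupsP => e eF; apply: bigcup_sup; exact: (subsetP s).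
Qed.

Lemma vertices_ofU F F' :
  vertices_of (F :|: F') = vertices_of F :|: vertices_of F'.
Proof. exact: bigcup_setU. Qed.

Lemma count_indep0 : count_indep set0.
Proof. by apply/count_indepP => F'; rewrite subset0 => ->. Qed.

Lemma count_indepS I J : I \subset J -> count_indep J -> count_indep I.
Proof.
move=> s /count_indepP h; apply/count_indepP => F' sF; apply: h.
exact: subset_trans sF s.
Qed.

Definition tight I T :=
  [&& T \subset I, T != set0 & #|T| + b == a * #|vertices_of T|].

Lemma tightU I T T' : count_indep I -> tight I T -> tight I T' ->
  T :&: T' != set0 -> tight I (T :|: T').
Proof.
move=> /count_indepP hI /and3P[s n /eqP t] /and3P[s' n' /eqP t'] nI.
have sU : T :|: T' \subset I by rewrite subUset s s'.
have nU : T :|: T' != set0 by rewrite setU_eq0 negb_and n.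
rewrite /tight sU nU eqn_leq hI //=.
have hcap : #|T :&: T'| + b <= a * #|vertices_of (T :&: T')|.
  by apply: hI => //; apply: subset_trans s; apply: subsetIl.
have hv : #|vertices_of (T :&: T')| <= #|vertices_of T :&: vertices_of T'|.
  by apply: subset_leq_card; rewrite subsetI !vertices_ofS ?subsetIl ?subsetIr.
have := cardsUI T T'; have := cardsUI (vertices_of T) (vertices_of T').
rewrite -vertices_ofU => eV eE.
have hcap' := leq_trans hcap (leq_mul (leqnn a) hv).
rewrite -(leq_add2r (#|T :&: T'| + b)) addnACA eE.
rewrite addnACA t t' -mulnDr -eV mulnDr leq_add2l; exact: hcap'.
Qed.

Lemma tight_blocker I e : 0 < a -> count_indep I -> count_indep [set e] ->
  ~~ count_indep (e |: I) ->
  exists2 T, tight I T & ends e \subset vertices_of T.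
Proof.
move=> a0 /count_indepP hI /count_indepP he /forallPn[F].
rewrite negb_imply -ltnNge => /andP[/andP[sF nF] lF].
have eF : e \in F.
  apply: contraTT lF => eF; rewrite -leqNgt; apply: hI => //.
  apply/subsetP => x xF; have := subsetP sF x xF; rewrite in_setU1.
  by case/predU1P=> // ex; rewrite -ex xF in eF.
pose T := F :\ e.
have sT : T \subset I by rewrite subDset.
have nT : T != set0.
  apply: contraTneq lF => T0; have Fe : F = [set e].
    by rewrite -(setD1K eF) -/T T0 setU0.
  by rewrite -leqNgt Fe; apply: he => //; rewrite -Fe.
have hT := hI T sT nT.
have cF : #|F| = #|T|.+1 by rewrite (cardsD1 e) eF.
have sV : vertices_of T \subset vertices_of F by apply: vertices_ofS; rewrite subD1set.
have cV := subset_leq_card sV.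
have lT : a * #|vertices_of F| <= #|T| + b by move: lF; rewrite cF addSn ltnS.
have eV : vertices_of T = vertices_of F.
  apply/eqP; rewrite eqEcard sV -(leq_pmul2l a0) /=; exact: leq_trans lT hT.
exists T; last by rewrite eV; apply: bigcup_sup.
by rewrite /tight sT nT eqn_leq hT eV.
Qed.

Lemma count_indep_aug I J : count_indep I -> count_indep J -> #|I| < #|J| ->
  exists2 e, e \in J :\: I & count_indep (e |: I).
Proof.
move=> hI hJ ltIJ.
have a0 : 0 < a.
  case: (posnP a) hJ => // a0 /count_indepP hJ.
  have J0 : J != set0 by rewrite -card_gt0; apply: leq_ltn_trans ltIJ.
  have := hJ J (subxx _) J0; rewrite a0 mul0n leqn0 addn_eq0 => /andP[/eqP c _].
  by rewrite c in ltIJ.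
case: (boolP [exists e in J :\: I, count_indep (e |: I)]).
  by case/exists_inP => e; exists e.
rewrite negb_exists_in => /forall_inP hn.
suff : #|J| <= #|I| by rewrite leqNgt ltIJ.
pose P := [set T | maxset (tight I) T].
have tP T : T \in P -> tight I T by rewrite inE => /maxsetp.
have tI : trivIset P.
  apply/trivIsetP => T T' PT PT'; apply: contraNT.
  rewrite -setI_eq0 => nI; have tU := tightU hI (tP _ PT) (tP _ PT') nI.
  move: PT PT'; rewrite !inE => /maxsetP[_ m] /maxsetP[_ m'].
  by rewrite -(m _ tU (subsetUl _ _)) (m' _ tU (subsetUr _ _)).
have sP : cover P \subset I by apply/bigcupsP => T /tP /and3P[].
pose JT T := [set e in J | ends e \subset vertices_of T].
have sJ : J \subset (\bigcup_(T in P) JT T) :|: (I :\: cover P).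
  apply/subsetP => e eJ; rewrite inE.
  case: (boolP (e \in I)) => eI.
    case: (boolP (e \in cover P)) => eC; last by rewrite inE eC eI orbT.
    apply/orP; left; case/bigcupP: eC => T PT eT.
    by apply/bigcupP; exists T => //; rewrite inE eJ; apply: bigcup_sup.
  have he : count_indep [set e] by apply: count_indepS hJ; rewrite sub1set.
  have nd : ~~ count_indep (e |: I) by apply: hn; rewrite inE eI eJ.
  case: (tight_blocker a0 hI he nd) => T tT sT.
  case: (maxset_exists tT) => T' mT' sTT'.
  apply/orP; left; apply/bigcupP; exists T'; rewrite inE // eJ /=.
  exact: subset_trans sT (vertices_ofS sTT').
apply: leq_trans (subset_leq_card sJ) _.
apply: leq_trans (leq_card_setU _ _) _.
rewrite -(cardsID (cover P) I) (setIidPr sP) leq_add2r.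
move: tI => /eqP <-.
have : #|\bigcup_(T in P) JT T| <= \sum_(T in P) #|JT T|.
  elim/big_rec2: _ => [|T n S _ h]; first by rewrite cards0.
  by apply: leq_trans (leq_card_setU _ _) _; rewrite leq_add2l.
move/leq_trans; apply; apply: leq_sum => T /tP /and3P[_ _ /eqP tT].
case: (eqVneq (JT T) set0) => [->|nJT]; first by rewrite cards0.
rewrite -(leq_add2r b) tT; move/count_indepP: hJ => hJ.
apply: leq_trans (hJ _ _ nJT) _.
  by apply/subsetP => e; rewrite inE => /andP[].
rewrite leq_pmul2l //; apply: subset_leq_card.
by apply/bigcupsP => e; rewrite inE => /andP[].
Qed.

Definition count_matroid : matroid (edge H) :=
  Matroid count_indep0 count_indepS count_indep_aug.

End CountMatroid.

(* Truncated subtraction: a - b is max(a - b, 0).  Pairs of distinct vertices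
   are 2-element vertex sets. *)
Section FullCountMatroid.
Variables (a b n : nat).

Definition K_edge : finType :=
  (('I_n * 'I_(a - b)) + ({A : {set 'I_n} | #|A| == 2} * 'I_(2 * a - b)))%type.

Definition K_ends (e : K_edge) : {set 'I_n} :=
  match e with
  | inl (v, _) => [set v]
  | inr (A, _) => val A
  end.

Lemma card_K_ends e : 0 < #|K_ends e| <= 2.
Proof. by case: e => [[v i]|[[A /= /eqP cA] i]] /=; rewrite ?cards1 ?cA. Qed.

Definition K_graph : multigraph := Multigraph card_K_ends.

Definition full_count_matroid : matroid (edge K_graph) :=
  count_matroid a b K_graph.

End FullCountMatroid.

(* Main.v *)
(* The classes [A] of the principal partition of a cyclic set [D] are its series
   classes, and [cl (D :\: A)] has corank [#|A| - 1] in [cl D].  Intersecting these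
   closures one at a time, submodularity gives the upper bound on the rank.
   For the lower bound, use that when [b <= a] the closure of a cyclic set is the
   union of the complete graphs on disjoint vertex sets, its parts.  If [A], [A']
   are distinct classes, [P] is the part of [cl (D :\: A)] containing [A'], and [Q]
   is the part of [cl (D :\: A')] containing [A], then [P :|: Q] contains the part
   [X] of [cl D] containing [A'].  Hence every edge of the intersection [G] of the
   closures already treated that is not in [cl (D :\: A')] lies in the complete
   graph on the intersection of [X] with all these [P].  Such a graph is
   modular with respect to [cl (D :\: A')], so each step of the upper bound
   is an equality. *)
Require Import Defs.
From mathcomp Require Import all_boot zify.

Set Implicit Arguments.
Unset Strict Implicit.
Unset Printing Implicit Defensive.

(** * Rank, closure and nullity in a matroid *)

Section MatroidRank.
Variables (E : finType) (M : matroid E).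
Implicit Types (A B C D I J X Y : {set E}) (x y e f : E) (k : nat).

Lemma card_indep_le_rank I X : I \subset X -> indep M I -> #|I| <= rank M X.
Proof. by move=> sI iI; apply: (@leq_bigmax_cond _ _ _ I); rewrite sI. Qed.

Lemma rank_leP X m :
  (forall I, I \subset X -> indep M I -> #|I| <= m) -> rank M X <= m.
Proof. by move=> h; apply/bigmax_leqP => I /andP[sI iI]; apply: h. Qed.

Lemma indep_extend I X : I \subset X -> indep M I ->
  exists J, [/\ I \subset J, J \subset X, indep M J & #|J| = rank M X].
Proof.
move em : (rank M X - #|I|) => m; elim: m I em => [|m IH] I hm sI iI.
  exists I; split=> //; apply/eqP; rewrite eqn_leq card_indep_le_rank //=; lia.
have [B /andP[sB iB] cB] : exists2 B : {set E}, (B \subset X) && indep M B & #|B| = rank M X.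
  have [|B hB eB] := @eq_bigmax_cond _ [pred B : {set E} | (B \subset X) && indep M B] (fun B => #|B|).
    by apply/card_gt0P; exists set0; rewrite inE sub0set indep0.
  by exists B; [exact: hB | rewrite /rank eB].
have [|e /setDP[eB eI] ie] := indep_aug iI iB; first by lia.
have [||J [sJ ? ? ?]] := IH (e |: I) _ _ ie.
- by rewrite cardsU1 eI; lia.
- by rewrite subUset sub1set (subsetP sB).
by exists J; split=> //; apply: subset_trans sJ; apply: subsetUr.
Qed.

Lemma rank_basis X : exists J, [/\ J \subset X, indep M J & #|J| = rank M X].
Proof.
by have [J [_ ? ? ?]] := indep_extend (sub0set X) (indep0 M); exists J.
Qed.

Lemma rankS X Y : X \subset Y -> rank M X <= rank M Y.
Proof.
move=> sXY; apply: rank_leP => I sI; apply: card_indep_le_rank.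
exact: subset_trans sXY.
Qed.

Lemma rank_le_card X : rank M X <= #|X|.
Proof. by apply: rank_leP => I /subset_leq_card. Qed.

Lemma rank_submod X Y :
  rank M (X :|: Y) + rank M (X :&: Y) <= rank M X + rank M Y.
Proof.
have [I [sI iI <-]] := rank_basis (X :&: Y).
have [|J [sIJ sJ iJ <-]] := @indep_extend I (X :|: Y) _ iI.
  by apply: subset_trans sI _; rewrite subIset // subsetUl.
have h Z : #|J :&: Z| <= rank M Z.
  by rewrite card_indep_le_rank ?subsetIr //; apply: indepS iJ; apply: subsetIl.
apply: leq_trans (leq_add (h X) (h Y)).
rewrite -(cardsUI (J :&: X)) -setIUr (setIidPl sJ) leq_add2l subset_leq_card //.
by rewrite -setIIr subsetI sIJ sI.
Qed.

Lemma rankU X Y : rank M (X :|: Y) <= rank M X + rank M Y.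
Proof. by have := rank_submod X Y; lia. Qed.

Lemma rank_le_setD X Y : rank M X <= rank M (X :&: Y) + rank M (X :\: Y).
Proof. by rewrite -{1}(setID X Y) rankU. Qed.

Lemma rank_bigcup (I : Type) (s : seq I) (F : I -> {set E}) :
  rank M (\bigcup_(i <- s) F i) <= \sum_(i <- s) rank M (F i).
Proof.
elim: s => [|i s IH]; last by rewrite !big_cons (leq_trans (rankU _ _)) ?leq_add2l.
by rewrite !big_nil (leq_trans (rank_le_card _)) ?cards0.
Qed.

(** Adding [Y :\: X] raises the rank by at most its size, so the nullity (size minus rank) is
    monotone; the terms are arranged to avoid truncated subtraction. *)
Lemma nullityS X Y : X \subset Y -> #|X| + rank M Y <= #|Y| + rank M X.
Proof.
move=> sXY; have := rank_le_setD Y X; rewrite (setIidPr sXY).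
have := rank_le_card (Y :\: X); have := cardsID X Y; rewrite (setIidPr sXY); lia.
Qed.

Lemma rank_setU_cl X Y : Y \subset cl M X -> rank M (X :|: Y) = rank M X.
Proof.
move=> sY; apply/eqP; rewrite eqn_leq (rankS (subsetUl X Y)) andbT leqNgt.
have [I [sI iI cI]] := rank_basis X; have [J [sJ iJ cJ]] := rank_basis (X :|: Y).
apply/negP=> lt; have [|e /setDP[eJ eI] ie] := indep_aug iI iJ; first by lia.
have [eX|eX] := boolP (e \in X).
  have := card_indep_le_rank (_ : e |: I \subset X) ie.
  by rewrite subUset sub1set eX sI cardsU1 eI cI => /(_ isT); rewrite add1n ltnn.
have: e \in cl M X.
  by apply: (subsetP sY); have := subsetP sJ e eJ; rewrite inE (negPf eX).
rewrite inE => /eqP re; have := card_indep_le_rank (setUS [set e] sI) ie.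
by rewrite re cardsU1 eI cI add1n ltnn.
Qed.

Lemma sub_cl X : X \subset cl M X.
Proof. by apply/subsetP=> e eX; rewrite inE (setUidPr _) ?sub1set. Qed.

Lemma rank_cl X : rank M (cl M X) = rank M X.
Proof. by rewrite -(rank_setU_cl (subxx (cl M X))) (setUidPr (sub_cl X)). Qed.

Lemma rank_eq_sub_cl X Y : X \subset Y -> rank M Y <= rank M X -> Y \subset cl M X.
Proof.
move=> sXY le; apply/subsetP=> e eY; rewrite inE eqn_leq (rankS (subsetUr [set e] X)) andbT.
by apply: leq_trans le; apply: rankS; rewrite subUset sub1set eY.
Qed.

Lemma clS X Y : X \subset Y -> cl M X \subset cl M Y.
Proof.
move=> sXY; apply/subsetP=> e; rewrite !inE => /eqP re.
have := rank_submod (e |: X) Y; rewrite -setUA (setUidPr sXY) re.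
have := rankS (_ : X \subset (e |: X) :&: Y); rewrite subsetI subsetUr sXY.
by move=> /(_ isT); have := rankS (subsetUr [set e] Y); lia.
Qed.

Lemma cyclic_setP D :
  reflect (forall e, e \in D -> rank M (D :\ e) = rank M D) (cyclic_set M D).
Proof.
by apply: (iffP forall_inP) => h e eD; [apply/eqP; apply: h | apply/eqP; apply: h].
Qed.

(** The fourth condition says that removing [A] lowers the nullity of [D] by one; the last, that
    deleting any [f] of [A] makes every other [e] of [A] a coloop. *)
Definition series_class D A :=
  [/\ A \subset D, A != set0, cyclic_set M (D :\: A),
      rank M (D :\: A) + #|A| = (rank M D).+1
    & {in A &, forall e f, e != f -> e \notin cl M (D :\ e :\ f)}].

(** * The principal partition as a partition into series classes *)

Section PrincipalPartition.
Variables (k : nat) (D : {set E}).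
Hypotheses (k_gt0 : 0 < k) (kD : kfold_circuit M k D).

Lemma principal_partitionP A :
  reflect (A \subset D /\ kfold_circuit M k.-1 (D :\: A))
          (A \in principal_partition M k D).
Proof.
apply: (iffP imsetP) => [[B] | [sA kA]].
  by rewrite inE => /andP[sB kB] ->; rewrite subsetDl setDDr setDv set0U (setIidPr sB).
by exists (D :\: A); rewrite ?inE ?subsetDl // setDDr setDv set0U (setIidPr sA).
Qed.

Lemma principal_partition_series A :
  A \in principal_partition M k D -> series_class D A.
Proof.
move: kD => /andP[/cyclic_setP cD /eqP eD].
move=> /principal_partitionP[sA /andP[cA /eqP eA]].
have cardA := cardsID A D; rewrite (setIidPr sA) in cardA.
split=> //; [|lia|].
  by apply/eqP=> A0; move: eA; rewrite A0 setD0; lia.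
(* If [e] were spanned, [D :\ e :\ f] would keep the rank of [D] and have nullity [k - 2], while its
   subset [D :\: A] has nullity [k - 1]. *)
move=> e f eA' fA nef; apply/negP; rewrite inE => /eqP re.
have eD' := subsetP sA e eA'; have fD := subsetP sA f fA.
have fDe : f \in D :\ e by rewrite !inE eq_sym nef.
have := nullityS (_ : D :\: A \subset D :\ e :\ f).
have -> : D :\: A \subset D :\ e :\ f.
  by rewrite !subsetD1 subsetDl !inE eA' fA.
have := cardsD1 e D; have := cardsD1 f (D :\ e); rewrite eD' fDe.
have -> : rank M (D :\ e :\ f) = rank M D.
  rewrite -(cD f fD) -re; congr rank; rewrite setDDl [_ :|: [set f]]setUC -setDDl.
  by rewrite setD1K // !inE nef.
by move=> + + /(_ isT); move: k_gt0 eD eA cardA; clear; lia.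
Qed.

(** Let [e] lie in both classes and [f] in [A] only, and let [U] be the union of the two
    complements. As [D :\: A'] is cyclic, [U :\ f] spans [f]; it contains [D :\: A], so [U] has
    nullity at least [k]. But [U] avoids [e], which leaves nullity at most [k - 1]. *)
Lemma principal_partition_trivIset : trivIset (principal_partition M k D).
Proof.
have /andP[/cyclic_setP cD /eqP eD] := kD.
suff sub A A' e : A \in principal_partition M k D ->
    A' \in principal_partition M k D -> e \in A -> e \in A' -> A \subset A'.
  apply/trivIsetP => A A' hA hA'; apply: contraNT.
  rewrite -setI_eq0 => /set0Pn[e /setIP[eA eA']].
  by rewrite eqEsubset (sub _ _ e) // (sub _ _ e).
move=> /principal_partitionP[sA /andP[cA /eqP eqA]].
move=> /principal_partitionP[sA' /andP[/cyclic_setP cA' /eqP eqA']] eA eA'.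
have eD' := subsetP sA e eA.
apply/subsetP=> f fA; apply/negPn/negP => fA'; have fD := subsetP sA f fA.
set B := D :\: A in cA eqA *; set B' := D :\: A' in cA' eqA' *.
have fB' : f \in B' by rewrite inE fA' fD.
have fU : f \in B :|: B' by rewrite inE fB' orbT.
have := nullityS (_ : B :|: B' \subset D :\ e).
rewrite subsetD1 subUset !subsetDl !inE eA eA' /= => /(_ isT).
have := nullityS (_ : B \subset (B :|: B') :\ f).
rewrite subsetD1 subsetUl !inE fA /= => /(_ isT).
have := clS (_ : B' :\ f \subset (B :|: B') :\ f).
rewrite setSD ?subsetUr // => /(_ isT) /subsetP /(_ f).
rewrite !inE !setD1K // cA' // eqxx => /(_ isT) /eqP.
have := cardsD1 f (B :|: B'); have := cardsD1 e D; rewrite eD' fU cD //.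
by move: k_gt0 eD eqA; clear; lia.
Qed.

(** For [e] in [D], a minimal subset of [D :\ e] of nullity [k - 1] is cyclic, since removing an
    element that lowers the rank keeps the nullity. Its complement in [D] is a class containing
    [e]. *)
Lemma cover_principal_partition : cover (principal_partition M k D) = D.
Proof.
have /andP[/cyclic_setP cD /eqP eD] := kD.
apply/eqP; rewrite eqEsubset; apply/andP; split.
  by apply/bigcupsP=> A /principal_partitionP[].
apply/subsetP=> e eD'.
pose p B := (B \subset D :\ e) && (rank M B + k.-1 == #|B|).
have [|B /minsetP[/andP[sB /eqP nB] mB] _] := @minset_exists _ p (D :\ e).
  by rewrite /p subxx cD //; have := cardsD1 e D; rewrite eD'; lia.
apply/bigcupP; exists (D :\: B); last first.
  by rewrite inE eD' andbT; apply/negP=> /(subsetP sB); rewrite !inE eqxx.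
have sBD : B \subset D by apply: subset_trans sB _; apply: subsetDl.
apply/principal_partitionP; rewrite subsetDl setDDr setDv set0U (setIidPr sBD).
split=> //; rewrite /kfold_circuit nB eqxx andbT; apply/cyclic_setP=> x xB.
have sx : B :\ x \subset B by apply: subsetDl.
apply/eqP; rewrite eqn_leq rankS //= leqNgt; apply/negP=> lt.
have := mB (B :\ x); rewrite /p (subset_trans sx) //=.
have := nullityS sx; have := cardsD1 x B; rewrite xB => h1 h2.
have -> : rank M (B :\ x) + k.-1 == #|B :\ x| by lia.
by move=> /(_ isT sx) hB; move: h1; rewrite hB; lia.
Qed.

End PrincipalPartition.

End MatroidRank.

(** * Ranks and vertex parts in a count matroid *)

Section CountRank.
Variables (a b : nat) (H : multigraph).
Local Notation M := (count_matroid a b H).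
Implicit Types (C F I J T : {set edge H}) (Y Z : {set vertex H}) (e f : edge H).
Implicit Types (Pi : {set {set vertex H}}).

Definition edges_in Z : {set edge H} := [set e | ends e \subset Z].

(* Truncated subtraction gives [rho set0 = 0], the rank of the empty edge set. *)
Definition rho Z : nat := a * #|Z| - b.

Lemma edges_inI Y Z : edges_in (Y :&: Z) = edges_in Y :&: edges_in Z.
Proof. by apply/setP=> e; rewrite !inE subsetI. Qed.

Lemma edges_inS Y Z : Y \subset Z -> edges_in Y \subset edges_in Z.
Proof. by move=> s; apply/subsetP=> e; rewrite !inE => /subset_trans; apply. Qed.

Lemma ends_neq0 e : exists v, v \in ends e.
Proof. by have /andP[/card_gt0P] := card_ends e. Qed.

Lemma edges_in_common e Y Z :
  e \in edges_in Y -> e \in edges_in Z -> ~~ [disjoint Y & Z].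
Proof.
rewrite !inE => sY sZ; have [v ve] := ends_neq0 e.
by apply/pred0Pn; exists v; rewrite /= (subsetP sY) ?(subsetP sZ).
Qed.

Lemma ends_sub_vertices_of e F : e \in F -> ends e \subset vertices_of F.
Proof. exact: bigcup_sup. Qed.

Lemma vertices_of_edges_in Z : vertices_of (edges_in Z) \subset Z.
Proof. by apply/bigcupsP=> e; rewrite inE. Qed.

Lemma rank_edges_in_le Z : rank M (edges_in Z) <= rho Z.
Proof.
apply: rank_leP => I sI /count_indepP iI.
have [->|nI] := eqVneq I set0; first by rewrite cards0.
have := iI I (subxx _) nI.
have : #|vertices_of I| <= #|Z|.
  apply: subset_leq_card; apply: subset_trans (vertices_of_edges_in Z).
  exact: vertices_ofS.
move/(leq_mul (leqnn a)); rewrite /rho; lia.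
Qed.

Lemma count_indep_disjointU I J : count_indep a b I -> count_indep a b J ->
  [disjoint vertices_of I & vertices_of J] -> count_indep a b (I :|: J).
Proof.
move=> /count_indepP iI /count_indepP iJ dIJ; apply/count_indepP=> F sF nF.
have eF : F = (F :&: I) :|: (F :&: J) by rewrite -setIUr (setIidPl sF).
have [F0|n1] := eqVneq (F :&: I) set0.
  by apply: iJ => //; rewrite eF F0 set0U subsetIr.
have [F0|n2] := eqVneq (F :&: J) set0.
  by apply: iI => //; rewrite eF F0 setU0 subsetIr.
have h1 := iI _ (subsetIr F I) n1; have h2 := iJ _ (subsetIr F J) n2.
have d : [disjoint vertices_of (F :&: I) & vertices_of (F :&: J)].
  apply: disjointWl (vertices_ofS (subsetIr F I)) _.
  exact: disjointWr (vertices_ofS (subsetIr F J)) dIJ.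
rewrite {2}eF vertices_ofU; move: d; rewrite -leq_card_setU => /eqP ->.
have := cardsUI (F :&: I) (F :&: J); rewrite -eF mulnDr; lia.
Qed.

Lemma rank_disjointU C F : [disjoint vertices_of C & vertices_of F] ->
  rank M C + rank M F <= rank M (C :|: F).
Proof.
move=> d; have [I [sI iI <-]] := rank_basis M C.
have [J [sJ iJ <-]] := rank_basis M F.
have dIJ : [disjoint vertices_of I & vertices_of J].
  by apply: disjointWl (vertices_ofS sI) (disjointWr (vertices_ofS sJ) d).
have IJ0 : I :&: J = set0.
  apply/setP=> e; rewrite !inE; apply/negP=> /andP[eI eJ].
  have [v ve] := ends_neq0 e.
  have := disjointFr dIJ (subsetP (ends_sub_vertices_of eI) v ve).
  by rewrite (subsetP (ends_sub_vertices_of eJ)).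
rewrite -cardsUI IJ0 cards0 addn0; apply: card_indep_le_rank; first exact: setUSS.
exact: count_indep_disjointU.
Qed.

Lemma rank_disjoint_bigcup (s : seq {set vertex H}) (F : {set vertex H} -> {set edge H}) :
  uniq s -> {in s &, forall Y Z, Y != Z -> [disjoint Y & Z]} ->
  (forall Y, F Y \subset edges_in Y) ->
  \sum_(Y <- s) rank M (F Y) <= rank M (\bigcup_(Y <- s) F Y).
Proof.
move=> + + sF; elim: s => [|Y s IH] /=; first by rewrite !big_nil.
move=> /andP[nY us] d; rewrite !big_cons.
have {}IH := IH us (sub_in2 (fun Z => @mem_behead _ (Y :: s) Z) d).
apply: leq_trans (rank_disjointU _); first by rewrite leq_add2l.
rewrite disjoints_subset; apply/subsetP=> v vY.
have {}vY : v \in Y.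
  by apply: (subsetP (vertices_of_edges_in Y)); apply: (subsetP (vertices_ofS (sF Y))).
rewrite inE; apply/negP=> /bigcupP[e].
rewrite big_seq; elim/big_ind: _ => [|A B hA hB|Z Zs]; first by rewrite inE.
  by rewrite inE => /orP[/hA|/hB].
move=> /(subsetP (sF Z)); rewrite inE => /subsetP sZ /sZ vZ.
have := d Y Z (mem_head _ _) (mem_behead _ : Z \in Y :: s).
have -> : Y != Z by apply: contraNneq nY => ->.
by move=> /(_ Zs isT) /disjointFr /(_ vY); rewrite vZ.
Qed.

(** The closure of [C] is the union of the sets [edges_in Z]: [parts_cl] gives one inclusion, and
    [parts_full] with [rank_edges_in_le] the other. [parts_cover] keeps vertices not met by [C] out
    of the parts. *)
Record vertex_parts C Pi : Prop := VertexParts {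
  parts_disjoint : {in Pi &, forall Y Z, Y != Z -> [disjoint Y & Z]};
  parts_rank : rank M C = \sum_(Z in Pi) rho Z;
  parts_cl : forall e, e \in cl M C -> exists2 Z, Z \in Pi & e \in edges_in Z;
  parts_full : forall Z, Z \in Pi -> rank M (C :&: edges_in Z) = rho Z;
  parts_cover : forall Z, Z \in Pi -> Z \subset vertices_of (C :&: edges_in Z)
}.

(** * Construction of the parts from maximal tight sets *)

Section Parts.
Hypotheses (a_gt0 : 0 < a) (le_ba : b <= a).

(** If no edge is shared, the two equalities give [#|T :|: T'| + 2b = a(|V(T)| + |V(T')|)], and a
    common vertex accounts for at least [a >= b] on the right, enough to reach the bound for the
    union. *)
Lemma tight_vertexU I T T' : count_indep a b I -> tight a b I T -> tight a b I T' ->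
  ~~ [disjoint vertices_of T & vertices_of T'] -> tight a b I (T :|: T').
Proof.
move=> iI tT tT' nd.
have [TT'|] := eqVneq (T :&: T') set0; last exact: tightU.
move/count_indepP: iI => iI.
move: tT tT' => /and3P[s n /eqP t] /and3P[s' n' /eqP t'].
have sU : T :|: T' \subset I by rewrite subUset s.
have nU : T :|: T' != set0 by rewrite setU_eq0 negb_and n.
rewrite /tight sU nU eqn_leq iI //=.
have := cardsUI T T'; rewrite TT' cards0 addn0 => ->.
have eV := cardsUI (vertices_of T) (vertices_of T').
have : 0 < #|vertices_of T :&: vertices_of T'| by rewrite card_gt0 setI_eq0.
rewrite vertices_ofU; set m := #|_ :&: _| in eV * => m0.
have : a <= a * m by rewrite leq_pmulr.
have : a * #|vertices_of T :|: vertices_of T'| + a * m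
     = a * #|vertices_of T| + a * #|vertices_of T'| by rewrite -!mulnDr eV.
lia.
Qed.

Lemma tight_setU1 I T e : tight a b I T -> ends e \subset vertices_of T ->
  e \notin T -> ~~ count_indep a b (e |: T).
Proof.
move=> /and3P[_ nT /eqP t] sV eT; apply/negP=> /count_indepP /(_ _ (subxx _)).
rewrite setU_eq0 negb_and nT orbT => /(_ isT).
have -> : vertices_of (e |: T) = vertices_of T.
  by rewrite vertices_ofU {1}/vertices_of big_set1; apply/setUidPr.
by rewrite cardsU1 eT -t; lia.
Qed.

(** For a basis [I] of [C], the parts are the vertex sets of the maximal tight subsets of [I], which
    are vertex-disjoint by [tight_vertexU]. Edges of [cl M C] outside [I] are blocked by tight
    sets. *)
Lemma cyclic_vertex_parts C : (forall e, count_indep a b [set e]) ->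
  cyclic_set M C -> exists Pi, vertex_parts C Pi.
Proof.
move=> i1 /cyclic_setP cC; have [I [sI iI cI]] := rank_basis M C.
have iI' : count_indep a b I := iI.
have blocked e : e \in cl M C -> e \notin I ->
    exists2 T, tight a b I T & ends e \subset vertices_of T.
  rewrite inE => /eqP re eI; apply: tight_blocker => //; apply/negP=> ie.
  have := @card_indep_le_rank _ M _ _ (setUS [set e] sI) ie.
  by rewrite re cardsU1 eI cI add1n ltnn.
(* Since [C] is cyclic, [e] can be exchanged for some [f] of [C] outside [I]. The tight set blocking
   [f] must contain [e], otherwise [f |: I :\ e] would be dependent. *)
have inT e : e \in I -> exists2 T, tight a b I T & e \in T.
  move=> eI; have eC := subsetP sI e eI.
  have [J [sJ iJ cJ]] := rank_basis M (C :\ e).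
  have iIe : indep M (I :\ e) by apply: indepS iI; apply: subsetDl.
  have [|f /setDP[fJ fI] iF] := indep_aug iIe iJ.
    by rewrite cJ cC // -cI (cardsD1 e I) eI.
  have /setD1P[nfe fC] := subsetP sJ f fJ.
  have {}fI : f \notin I by apply: contra fI => fI; rewrite !inE nfe.
  have [T tT sT] := blocked f (subsetP (sub_cl M C) f fC) fI.
  have /and3P[sTI _ _] := tT.
  exists T => //; apply/negPn/negP => eT.
  have /negP[] := tight_setU1 tT sT (contra (subsetP sTI f) fI).
  by apply: count_indepS iF; apply: setUS; rewrite subsetD1 sTI.
pose P := [set T | maxset (tight a b I) T].
have tP T : T \in P -> tight a b I T by rewrite inE => /maxsetp.
have supP T : tight a b I T -> exists2 T', T' \in P & T \subset T'.
  by move=> /maxset_exists[T' mT' sT']; exists T'; rewrite ?inE.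
have dP : {in P &, forall T T', T != T' -> [disjoint vertices_of T & vertices_of T']}.
  move=> T T' PT PT'; apply: contraNT => nd.
  have tU := tight_vertexU iI (tP _ PT) (tP _ PT') nd.
  move: PT PT'; rewrite !inE => /maxsetP[_ m] /maxsetP[_ m'].
  by rewrite -(m _ tU (subsetUl _ _)) (m' _ tU (subsetUr _ _)).
have vP T : T \in P -> exists v, v \in vertices_of T.
  move=> /tP/and3P[_ /set0Pn[e eT] _]; have [v ve] := ends_neq0 e.
  by exists v; apply: (subsetP (ends_sub_vertices_of eT)).
have injP : {in P &, injective (@vertices_of H)}.
  move=> T T' PT PT' eV; apply/eqP/negPn/negP => /(dP _ _ PT PT').
  by have [v vT] := vP T PT; move=> /disjointFr/(_ vT); rewrite -eV vT.
have rhoT T : T \in P -> #|T| = rho (vertices_of T).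
  by move=> /tP/and3P[_ _ /eqP t]; rewrite /rho -t addnK.
have sT T : T \in P -> T \subset C :&: edges_in (vertices_of T).
  move=> /tP/and3P[sT _ _]; rewrite subsetI (subset_trans sT sI) /=.
  by apply/subsetP=> e eT; rewrite inE ends_sub_vertices_of.
exists [set vertices_of T | T in P]; split.
- move=> _ _ /imsetP[T PT ->] /imsetP[T' PT' ->] nT; apply: dP => //.
  by apply: contraNneq nT => ->.
- rewrite big_imset //= -cI.
  have trP : trivIset P.
    apply/trivIsetP=> T T' PT PT' nT; rewrite -setI_eq0; apply/eqP/setP=> e.
    rewrite !inE; apply/negP=> /andP[eT eT']; have [v ve] := ends_neq0 e.
    have := disjointFr (dP _ _ PT PT' nT) (subsetP (ends_sub_vertices_of eT) v ve).
    by rewrite (subsetP (ends_sub_vertices_of eT')).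
  have -> : I = cover P.
    apply/eqP; rewrite eqEsubset; apply/andP; split.
      apply/subsetP=> e /inT[T /supP[T' PT' sTT'] eT].
      by apply/bigcupP; exists T' => //; apply: (subsetP sTT').
    by apply/bigcupsP=> T /tP/and3P[].
  by move/eqP: trP => <-; apply: eq_bigr => T /rhoT.
- move=> e eC; have [T tT sV] : exists2 T, tight a b I T & ends e \subset vertices_of T.
    have [/inT[T tT eT]|] := boolP (e \in I); last exact: blocked.
    by exists T => //; apply: ends_sub_vertices_of.
  have [T' PT' sTT'] := supP _ tT; exists (vertices_of T'); first exact: imset_f.
  by rewrite inE (subset_trans sV) ?vertices_ofS.
- move=> _ /imsetP[T PT ->]; apply/eqP; rewrite eqn_leq; apply/andP; split.
    by apply: leq_trans (rank_edges_in_le _); apply: rankS; apply: subsetIr.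
  rewrite -rhoT //; apply: card_indep_le_rank; first exact: sT.
  by apply: indepS iI; have /and3P[] := tP T PT.
- by move=> _ /imsetP[T PT ->]; apply: vertices_ofS; apply: sT.
Qed.

End Parts.

(** * Consequences of a decomposition into parts *)

Section PartsTheory.
Variables (C : {set edge H}) (Pi : {set {set vertex H}}).
Hypothesis partsC : vertex_parts C Pi.

Lemma parts_sub e : e \in C -> exists2 Z, Z \in Pi & e \in edges_in Z.
Proof. by move=> eC; apply: (parts_cl partsC); apply: (subsetP (sub_cl _ _)). Qed.

(** The edges of [C] inside [Z] already have the largest rank possible there, hence span all edges
    inside [Z]. *)
Lemma parts_edges_in_cl Z C' : Z \in Pi -> C :&: edges_in Z \subset C' ->
  edges_in Z \subset cl M C'.
Proof.
move=> PZ s; apply: subset_trans (clS M s).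
apply: rank_eq_sub_cl; first exact: subsetIr.
by rewrite (parts_full partsC) ?rank_edges_in_le.
Qed.

Lemma parts_sub_or_disjoint e Y : e \in C -> Y \in Pi ->
  e \in edges_in Y \/ [disjoint ends e & Y].
Proof.
move=> /parts_sub[Z PZ eZ] PY; have [<-|nZY] := eqVneq Z Y; first by left.
by right; apply: disjointWl (parts_disjoint partsC PZ PY nZY); rewrite inE in eZ.
Qed.

Lemma rank_parts_setD F Z : Z \in Pi -> F \subset cl M C ->
  rank M (F :\: edges_in Z) + rho Z <= rank M C.
Proof.
move=> PZ sF; rewrite (parts_rank partsC) (bigD1 Z) //= addnC leq_add2l.
rewrite -big_enum_cond /= -big_filter.
apply: leq_trans (leq_sum _ (fun Y _ => rank_edges_in_le Y)).
apply: leq_trans (rank_bigcup _ _ _); apply: rankS; apply/subsetP=> e /setDP[eF eZ].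
have [Y PY eY] := parts_cl partsC (subsetP sF e eF).
rewrite big_filter big_enum_cond; apply/bigcupP; exists Y => //.
by rewrite PY; apply: contraNneq eZ => <-.
Qed.

(* If [e] and [f] of [A] were in different parts, then [e] would be spanned
   by the rest of its own part, which avoids [f]. *)
Lemma series_class_in_part D A Z e : series_class M D A -> cyclic_set M C ->
  C \subset D -> A \subset C -> Z \in Pi -> e \in A -> e \in edges_in Z ->
  A \subset edges_in Z.
Proof.
move=> [_ _ _ _ series] /cyclic_setP cC sCD sAC PZ eA eZ.
apply/subsetP=> f fA; have [-> //|nfe] := eqVneq f e.
have eC := subsetP sAC e eA.
rewrite eq_sym in nfe; apply/negPn/negP=> fZ; have /negP[] := series e f eA fA nfe.
(* Removing [e] keeps the rank of [C], to which the edges outside [Z] contribute at most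
   [rank M C - rho Z]; so the edges of [C :\ e] inside [Z] still have rank [rho Z]. *)
have := rank_le_setD M (C :\ e) (edges_in Z); rewrite cC //.
have -> : (C :\ e) :\: edges_in Z = C :\: edges_in Z.
  by apply/setP=> x; rewrite !inE; case: eqP => // ->; rewrite inE in eZ; rewrite eZ.
have := rank_parts_setD PZ (sub_cl M C); rewrite -(parts_full partsC PZ) => h1 h2.
have : C :&: edges_in Z \subset cl M ((C :\ e) :&: edges_in Z).
  apply: rank_eq_sub_cl; last by lia.
  by apply: setSI; apply: subsetDl.
move/subsetP/(_ e); rewrite inE eC eZ => /(_ isT); apply: (subsetP (clS M _)).
apply/subsetP=> x; rewrite in_setI !in_setD1 => /andP[/andP[-> /(subsetP sCD) ->] xZ].
by rewrite !andbT; apply: contraNneq fZ => <-.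
Qed.

End PartsTheory.

End CountRank.

Lemma sum_card_setI_le (T : finType) (P : {set {set T}}) (W : {set T}) :
  {in P &, forall Y Z : {set T}, Y != Z -> [disjoint Y & Z]} ->
  \sum_(Y in P) #|Y :&: W| <= #|W|.
Proof.
move=> dP; have cardI (Y : {set T}) : #|Y :&: W| = \sum_(v in W) (v \in Y).
  rewrite -sum1_card big_mkcond [RHS]big_mkcond; apply: eq_bigr => v _.
  by rewrite inE; case: (v \in Y); case: (v \in W).
rewrite (eq_bigr _ (fun Y _ => cardI Y)) exchange_big /= -sum1_card.
apply: leq_sum => v _; rewrite -big_mkcondr sum1_card.
apply/card_le1_eqP => Y Z /andP[PY vY] /andP[PZ vZ]; apply/eqP/negPn/negP=> nYZ.
by have := disjointFr (dP Z Y PZ PY nYZ) vZ; rewrite vY.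
Qed.

(** * The full count matroid: ranks of complete graphs and modularity *)

Section FullCount.
Variables (a b n : nat).
Hypotheses (b_gt0 : 0 < b) (le_ba : b <= a).
Local Notation H := (K_graph a b n).
Local Notation M := (count_matroid a b H).
Implicit Types (A C D F I : {set edge H}) (Y Z X P Q : {set vertex H}).
Implicit Types (e f : edge H) (u v z : vertex H).

Let a_gt0 : 0 < a. Proof. lia. Qed.

Lemma count_indep_card F : (forall e, e \in F -> #|F| + b <= a * #|ends e|) ->
  count_indep a b F.
Proof.
move=> h; apply/count_indepP=> F' sF' /set0Pn[e eF'].
have := h e (subsetP sF' e eF'); have := subset_leq_card sF'.
have /(leq_mul (leqnn a)) := subset_leq_card (ends_sub_vertices_of eF').
by lia.
Qed.

Lemma full_count_indep1 e : count_indep a b [set e].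
Proof.
apply: count_indep_card => f /set1P ->; rewrite cards1.
case: e => [[v i]|[[B /= /eqP cB] i]] /=; last by rewrite cB; lia.
by rewrite cards1; have := ltn_ord i; lia.
Qed.

Lemma exists_edge u v : u != v -> exists e, ends e = [set u; v].
Proof.
move=> nuv; have c2 : #|[set u; v]| == 2 by rewrite cards2 nuv.
have lt : 0 < 2 * a - b by lia.
by exists (inr (exist _ [set u; v] c2, Ordinal lt)).
Qed.

Definition loops_at v : {set edge H} :=
  [set (inl (v, i) : edge H) | i : 'I_(a - b)].

Lemma card_loops_at v : #|loops_at v| = a - b.
Proof. by rewrite card_imset ?card_ord // => i j []. Qed.

Lemma ends_loops_at v e : e \in loops_at v -> ends e = [set v].
Proof. by case/imsetP=> i _ ->. Qed.

Lemma exists_parallel_class u v : u != v ->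
  exists N : {set edge H}, #|N| = b /\ {in N, forall e, ends e = [set u; v]}.
Proof.
move=> nuv; have c2 : #|[set u; v]| == 2 by rewrite cards2 nuv.
have le : b <= 2 * a - b by lia.
exists [set (inr (exist _ [set u; v] c2, widen_ord le i) : edge H) | i : 'I_b].
split; last by move=> _ /imsetP[i _ ->].
rewrite card_imset ?card_ord // => i j [] h.
exact: val_inj.
Qed.

(* [v] is attached to [Z] by [a - b] loops and [b] edges to one vertex of [Z]. *)
Lemma rank_edges_in_setU1 v Z : Z != set0 -> v \notin Z ->
  rank M (edges_in Z) + a <= rank M (edges_in (v |: Z)).
Proof.
move=> /set0Pn[z zZ] vZ.
have nvz : v != z by apply: contraNneq vZ => ->.
have [N [cN eN]] := exists_parallel_class nvz.
pose L := loops_at v :|: N.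
have endsL e : e \in L -> v \in ends e /\ ends e \subset v |: Z.
  case/setUP=> [/ends_loops_at ->|/eN ->]; rewrite !inE eqxx; split=> //.
    exact: subsetUl.
  by apply: setUS; rewrite sub1set.
have cL : #|L| = a.
  have LN0 : loops_at v :&: N = set0.
    apply/setP=> e; rewrite !inE; apply/negP=> /andP[/ends_loops_at e1 /eN].
    by rewrite e1 => /setP/(_ z); rewrite !inE eqxx orbT eq_sym (negPf nvz).
  have := cardsUI (loops_at v) N; rewrite card_loops_at cN LN0 cards0 /L.
  by lia.
have [I [sI iI <-]] := rank_basis M (edges_in Z).
have IL0 : I :&: L = set0.
  apply/setP=> e; rewrite !inE; apply/negP=> /andP[/(subsetP sI)].
  rewrite inE => /subsetP sZ eL; have [] := endsL e _; first by rewrite !inE.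
  by move=> /sZ; rewrite (negPf vZ).
have <- : #|I :|: L| = #|I| + a by have := cardsUI I L; rewrite IL0 cards0 cL addn0.
apply: card_indep_le_rank.
  rewrite subUset (subset_trans sI (edges_inS (subsetUr _ _))) /=.
  by apply/subsetP=> e /endsL[_]; rewrite inE.
apply/count_indepP=> F sF nF.
have cF : #|F| = #|F :&: I| + #|F :&: L|.
  rewrite -cardsUI -setIUr (setIidPl sF) -setIIr IL0 setI0 cards0.
  by rewrite addn0.
have [F0|/set0Pn[e /setIP[eF eL]]] := eqVneq (F :&: L) set0.
  move/count_indepP: iI; apply=> //; apply/setIidPl.
  by rewrite -[RHS](setIidPl sF) setIUr F0 setU0.
have vF : v \in vertices_of F.
  by apply: (subsetP (ends_sub_vertices_of eF)); have [] := endsL e eL.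
have cFL : #|F :&: L| <= a by have := subset_leq_card (subsetIr F L); rewrite cL.
(* With only new edges, an edge of [N] provides two vertices and [a + b <= 2a]; without one there
   are at most [a - b] loops, at one vertex. *)
have [F0|nFI] := eqVneq (F :&: I) set0.
  rewrite cF F0 cards0 add0n.
  have [/set0Pn[f /setIP[fF /eN ef]]|FN0] := boolP (F :&: N != set0).
    have /(leq_mul (leqnn a)) := subset_leq_card (ends_sub_vertices_of fF).
    by rewrite ef cards2 nvz; move: cFL le_ba; clear; lia.
  have : #|F :&: L| <= a - b.
    rewrite -(card_loops_at v) subset_leq_card //.
    by rewrite /L setIUr (eqP (negPn FN0)) setU0 subsetIr.
  have : 0 < #|vertices_of F| by apply/card_gt0P; exists v.
  by move/(leq_mul (leqnn a)); move: le_ba; clear; lia.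
have /count_indepP/(_ _ (subsetIr F I) nFI) hI := iI.
have sV : v |: vertices_of (F :&: I) \subset vertices_of F.
  by rewrite subUset sub1set vF vertices_ofS ?subsetIl.
have vI : v \notin vertices_of (F :&: I).
  apply: contra vZ => /(subsetP (vertices_ofS (subsetIr _ _))).
  by move=> /(subsetP (vertices_ofS sI)) /(subsetP (vertices_of_edges_in _)).
have /(leq_mul (leqnn a)) := subset_leq_card sV.
by rewrite cardsU1 vI mulnDr cF; move: hI cFL; clear; lia.
Qed.

Lemma rank_edges_in Z : rank M (edges_in Z) = rho a b Z.
Proof.
apply/eqP; rewrite eqn_leq rank_edges_in_le andTb.
move em : #|Z| => m; elim: m Z em => [|m IH] Z cZ; first by rewrite /rho cZ; lia.
have [v vZ] : exists v, v \in Z by apply/card_gt0P; rewrite cZ.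
have eZ := setD1K vZ; have vZ' : v \notin Z :\ v by rewrite !inE eqxx.
have cZ' : #|Z :\ v| = m by move: cZ; rewrite (cardsD1 v) vZ => -[].
have [Z0|nZ] := eqVneq (Z :\ v) set0; last first.
  have := rank_edges_in_setU1 nZ vZ'; have := IH _ cZ'.
  have : a <= a * m by rewrite leq_pmulr // -cZ' card_gt0.
  by rewrite eZ /rho cZ cZ' mulnS; move: le_ba; clear; lia.
(* For a single vertex [rho] is [a - b], attained by the loops. *)
have {}eZ : Z = [set v] by rewrite -eZ Z0 setU0.
rewrite /rho eZ cards1 muln1 -(card_loops_at v); apply: card_indep_le_rank.
  by apply/subsetP=> e /ends_loops_at; rewrite inE => ->.
apply: count_indep_card => e /ends_loops_at ->.
by rewrite card_loops_at cards1; lia.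
Qed.

Lemma full_vertex_parts C : cyclic_set M C -> exists Pi, vertex_parts a b C Pi.
Proof. by apply: cyclic_vertex_parts => //; apply: full_count_indep1. Qed.

(* Modularity of [edges_in Z] with respect to closures of cyclic sets, which
   fails for general closed sets. *)
Lemma rank_cl_edges_in D C PiD PiC X Z : vertex_parts a b D PiD ->
  vertex_parts a b C PiC -> C \subset D -> X \in PiD -> Z \subset X -> Z != set0 ->
  rho a b Z + rank M C <= rank M (cl M C :&: edges_in Z) + rank M D.
Proof.
move=> hD hC sCD PX sZX nZ.
have h1 := rank_le_setD M C (edges_in X).
have h2 := rank_parts_setD hD PX (subset_trans sCD (sub_cl M D)).
have h3 : rank M (C :&: edges_in X) <= \sum_(Y in PiC) rho a b (Y :&: X).
  rewrite -big_enum; apply: leq_trans (leq_sum _ (fun Y _ => rank_edges_in_le _ _ (Y :&: X))).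
  apply: leq_trans (rank_bigcup _ _ _); apply: rankS; apply/subsetP=> e /setIP[eC eX].
  have [Y PY eY] := parts_sub hC eC.
  by rewrite big_enum; apply/bigcupP; exists Y; rewrite // edges_inI inE eY.
(* By truncation, [rho] grows by at most [a] per added vertex, also from the empty set. *)
have h4 : \sum_(Y in PiC) rho a b (Y :&: X)
    <= \sum_(Y in PiC) rho a b (Y :&: Z) + a * #|X :\: Z|.
  have hY Y : rho a b (Y :&: X) <= rho a b (Y :&: Z) + a * #|Y :&: (X :\: Z)|.
    have := cardsID Z (Y :&: X); rewrite -setIA (setIidPr sZX) -setIDA /rho => <-.
    by rewrite mulnDr; clear; lia.
  apply: leq_trans (leq_sum _ (fun Y _ => hY Y)) _; rewrite big_split leq_add2l.
  by rewrite -big_distrr leq_mul2l sum_card_setI_le ?orbT //; apply: (parts_disjoint hC).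
(* The complete graphs on the sets [Y :&: Z] lie in [cl M C] and are vertex-disjoint, so their ranks
   add up. *)
have h5 : \sum_(Y in PiC) rho a b (Y :&: Z) <= rank M (cl M C :&: edges_in Z).
  rewrite -big_enum.
  under eq_bigr => Y _ do rewrite -rank_edges_in.
  apply: leq_trans (rank_disjoint_bigcup _ _ _ _ _) _.
  - exact: enum_uniq.
  - by move=> Y Y'; rewrite !mem_enum; apply: (parts_disjoint hC).
  - by move=> Y; apply: edges_inS; apply: subsetIl.
  apply: rankS; rewrite big_enum; apply/bigcupsP=> Y PY; rewrite edges_inI.
  by apply: setSI; apply: (parts_edges_in_cl hC PY); apply: subsetIl.
(* Equality holds because [Z] is nonempty and [b <= a], so nothing is truncated. *)
have h6 : rho a b Z + a * #|X :\: Z| = rho a b X.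
  have := cardsID Z X; rewrite (setIidPr sZX) /rho => <-.
  have : a <= a * #|Z| by rewrite leq_pmulr // card_gt0.
  by rewrite mulnDr; move: le_ba; clear; lia.
by move: h1 h2 h3 h4 h5 h6; clear; lia.
Qed.

(** * Comparing the closures obtained from two series classes *)

Section PairOfClasses.
Variables (D A A' : {set edge H}) (PiA PiA' : {set {set vertex H}}).
Hypotheses (hA : vertex_parts a b (D :\: A) PiA).
Hypotheses (hA' : vertex_parts a b (D :\: A') PiA').

(** No edge of [A'] lies inside [Y], so [D :\: A'] spans the complete graph on [Y]. An edge from [v]
    to another vertex of [Y] thus lies inside one part of [D :\: A'], which is [Y'] because it
    contains [v]. *)
Lemma part_sub_part P Y Y' v : P \in PiA -> A' \subset edges_in P ->
  Y \in PiA -> Y != P -> Y' \in PiA' -> v \in Y -> v \in Y' -> Y \subset Y'.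
Proof.
move=> PP sA' PY nYP PY' vY vY'.
have sY : edges_in Y \subset cl M (D :\: A').
  apply: (parts_edges_in_cl hA PY); apply/subsetP=> e /setIP[/setDP[eD _] eY].
  rewrite inE eD andbT; apply/negP=> /(subsetP sA') eP.
  by have := edges_in_common eY eP; rewrite (parts_disjoint hA).
apply/subsetP=> u uY; have [-> //|nuv] := eqVneq u v.
have [e ee] := exists_edge nuv.
have /(parts_cl hA')[Z PZ] : e \in cl M (D :\: A').
  by apply: (subsetP sY); rewrite inE ee subUset !sub1set uY.
rewrite inE ee subUset !sub1set => /andP[uZ vZ].
have [<- //|nZ] := eqVneq Z Y'.
by have := disjointFr (parts_disjoint hA' PZ PY' nZ) vZ; rewrite vY'.
Qed.

End PairOfClasses.

(* Otherwise the two closures share a part [Y] different from [P] and [Q], so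
   no edge of [D] joins [Y] to its complement, and the rank of the part [X]
   of [D] is too small. *)
Lemma part_sub_setU D A A' PiD PiA PiA' X P Q : vertex_parts a b D PiD ->
  vertex_parts a b (D :\: A) PiA -> vertex_parts a b (D :\: A') PiA' ->
  [disjoint A & A'] -> A' \subset D -> A' != set0 ->
  X \in PiD -> A' \subset edges_in X ->
  P \in PiA -> A' \subset edges_in P -> Q \in PiA' -> A \subset edges_in Q ->
  X \subset P :|: Q.
Proof.
move=> hD hA hA' dAA' sA'D /set0Pn[f fA'] PX sA'X PP sA'P PQ sAQ.
apply/subsetP=> v vX; apply/negPn/negP; rewrite inE negb_or => /andP[vP vQ].
have /bigcupP[e /setIP[eD eX] ve] := subsetP (parts_cover hD PX) v vX.
have eA : e \notin A.
  apply: contra vQ => /(subsetP sAQ); rewrite inE => /subsetP; exact.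
have eA' : e \notin A'.
  apply: contra vP => /(subsetP sA'P); rewrite inE => /subsetP; exact.
have [|Y PY eY] := parts_sub hA (_ : e \in D :\: A); first by rewrite inE eA.
have [|Y' PY' eY'] := parts_sub hA' (_ : e \in D :\: A'); first by rewrite inE eA'.
have vY : v \in Y by move: eY; rewrite inE => /subsetP; apply.
have vY' : v \in Y' by move: eY'; rewrite inE => /subsetP; apply.
have nYP : Y != P by apply: contraNneq vP => <-.
have nYQ : Y' != Q by apply: contraNneq vQ => <-.
have eYY' : Y = Y'.
  apply/eqP; rewrite eqEsubset (part_sub_part hA hA' PP sA'P PY nYP PY' vY vY').
  by rewrite (part_sub_part hA' hA PQ sAQ PY' nYQ PY vY' vY).
have splitD g : g \in D -> g \in edges_in Y \/ [disjoint ends g & Y].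
  move=> gD; have [gA|gA] := boolP (g \in A); last first.
    by apply: (parts_sub_or_disjoint hA); rewrite // inE gA.
  rewrite eYY'; apply: (parts_sub_or_disjoint hA') => //.
  by rewrite inE gD andbT (disjointFr dAA').
have [w wf] := ends_neq0 f.
have wX : w \in X.
  by have := subsetP sA'X f fA'; rewrite inE => /subsetP; apply.
have wY : w \notin Y.
  have wP : w \in P by have := subsetP sA'P f fA'; rewrite inE => /subsetP; apply.
  by rewrite (disjointFl (parts_disjoint hA PY PP nYP) wP).
have := parts_full hD PX.
have : rank M (D :&: edges_in X) <= rank M (edges_in (X :&: Y) :|: edges_in (X :\: Y)).
  apply: rankS; apply/subsetP=> g /setIP[gD]; rewrite !inE subsetI subsetD => gX.
  by rewrite gX /=; apply/orP; case: (splitD g gD); rewrite ?inE; [left | right].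
have := rankU M (edges_in (X :&: Y)) (edges_in (X :\: Y)).
have := rank_edges_in_le a b (X :&: Y); have := rank_edges_in_le a b (X :\: Y).
(* Both pieces of [X] are nonempty, so their bounds add up to [a|X| - 2b], below [rho X] since
   [b > 0]. *)
have : 0 < #|X :&: Y| by apply/card_gt0P; exists v; rewrite inE vX.
have : 0 < #|X :\: Y| by apply/card_gt0P; exists w; rewrite inE wX wY.
have := cardsID Y X; rewrite /rho => <-; rewrite mulnDr.
move=> /(leq_mul (leqnn a)) + /(leq_mul (leqnn a)).
by move: b_gt0 le_ba; clear; lia.
Qed.

(** [P] and [Q] cover [X], so an edge inside [X] from a part of [D :\: A] other than [P] has all its
    ends in [Q] and is spanned by [D :\: A']. *)
Lemma part_split D A A' PiD X : vertex_parts a b D PiD ->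
  series_class M D A -> series_class M D A' -> [disjoint A & A'] ->
  X \in PiD -> A' \subset edges_in X ->
  exists P, edges_in P \subset cl M (D :\: A) /\
    forall e, e \in edges_in X -> e \in cl M (D :\: A) ->
      e \in edges_in P \/ e \in cl M (D :\: A').
Proof.
move=> hD sA sA' dAA' PX sA'X.
have [sAD nA cA _ _] := sA; have [sAD' nA' cA' _ _] := sA'.
have [PiA hA] := full_vertex_parts cA.
have [PiA' hA'] := full_vertex_parts cA'.
have sA'DA : A' \subset D :\: A by rewrite subsetD sAD' disjoint_sym.
have sADA' : A \subset D :\: A' by rewrite subsetD sAD.
have [f fA'] := set0Pn _ nA'; have [g gA] := set0Pn _ nA.
have [P PP fP] := parts_sub hA (subsetP sA'DA f fA').
have [Q PQ gQ] := parts_sub hA' (subsetP sADA' g gA).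
have sP := series_class_in_part hA sA' cA (subsetDl _ _) sA'DA PP fA' fP.
have sQ := series_class_in_part hA' sA cA' (subsetDl _ _) sADA' PQ gA gQ.
have sX := part_sub_setU hD hA hA' dAA' sAD' nA' PX sA'X PP sP PQ sQ.
exists P; split; first by apply: (parts_edges_in_cl hA PP); apply: subsetIl.
move=> e eX /(parts_cl hA)[Y PY eY]; have [<-|nYP] := eqVneq Y P; first by left.
right; apply: (subsetP (parts_edges_in_cl hA' PQ (subsetIl _ _))).
rewrite inE; apply/subsetP=> v ve; move: eX eY; rewrite !inE => /subsetP/(_ v ve) vX.
move=> /subsetP/(_ v ve) vY; have := subsetP sX v vX.
by rewrite inE (disjointFr (parts_disjoint hA PY PP nYP) vY).
Qed.

(** * Intersecting the closures one at a time *)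

(** A list allows induction over the classes; [cl M D] is included so that the empty list gives the
    closure of [D]. *)
Definition cl_cap D (s : seq {set edge H}) : {set edge H} :=
  [set e in cl M D | all (fun A => e \in cl M (D :\: A)) s].

Lemma rank_cl_cap_cons D s A' : cyclic_set M D -> series_class M D A' ->
  (forall A, A \in s -> series_class M D A /\ [disjoint A & A']) ->
  rank M (cl_cap D (A' :: s)) + rank M D
    = rank M (cl_cap D s) + rank M (D :\: A').
Proof.
move=> cD sA' hs; have [sAD' nA' cA' _ _] := sA'.
set G := cl_cap D s; set F := cl M (D :\: A').
have eG : cl_cap D (A' :: s) = G :&: F.
  by apply/setP=> e; rewrite !inE /= !inE andbCA andbC.
rewrite eG; apply/eqP; rewrite eqn_leq -(rank_cl M (D :\: A')); apply/andP; split.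
  apply: leq_trans (rank_submod M G F); rewrite addnC leq_add2r; apply: rankS.
  (* [D] lies in [G :|: F]: by disjointness [A'] survives in the closures for [s], and the rest of
     [D] lies in [F]. *)
  apply/subsetP=> e eD; have [eA'|eA'] := boolP (e \in A'); last first.
    by rewrite inE; apply/orP; right; apply: (subsetP (sub_cl _ _)); rewrite inE eA'.
  rewrite inE; apply/orP; left; rewrite inE (subsetP (sub_cl _ _)) //=.
  apply/allP=> A /hs[_ dA]; apply: (subsetP (sub_cl _ _)).
  by rewrite inE eD (disjointFl dA eA').
have [PiD hD] := full_vertex_parts cD.
have [PiA' hA'] := full_vertex_parts cA'.
have [f fA'] := set0Pn _ nA'.
have [X PX fX] := parts_sub hD (subsetP sAD' f fA').
have sA'X := series_class_in_part hD sA' cD (subxx D) sAD' PX fA' fX.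
have /fin_all_exists[P hP] A : exists P, A \in s ->
    edges_in P \subset cl M (D :\: A) /\
    forall e, e \in edges_in X -> e \in cl M (D :\: A) -> e \in edges_in P \/ e \in F.
  have [As|nAs] := boolP (A \in s); last by exists set0.
  by have [sA dA] := hs A As; have [P hP] := part_split hD sA sA' dA PX sA'X; exists P.
(* [edges_in Z] lies in [G] and contains every edge of [G] outside [F]. *)
pose Z := [set v in X | all (fun A => v \in P A) s].
have sZX : Z \subset X by apply/subsetP=> v; rewrite inE => /andP[].
have sZP A : A \in s -> Z \subset P A.
  by move=> As; apply/subsetP=> v; rewrite inE => /andP[_ /allP]; apply.
have sZG : edges_in Z \subset G.
  apply/subsetP=> e eZ; rewrite inE.
  rewrite (subsetP (parts_edges_in_cl hD PX (subsetIl _ _))) /=; last first.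
    by apply: (subsetP (edges_inS sZX)).
  apply/allP=> A As; have [sP _] := hP A As; apply: (subsetP sP).
  by apply: (subsetP (edges_inS (sZP A As))).
have sG : G \subset (G :&: F) :|: edges_in Z.
  apply/subsetP=> e eG'; rewrite in_setU in_setI eG' /=.
  have [//|eF /=] := boolP (e \in F).
  move: eG'; rewrite inE => /andP[eD /allP eall].
  (* A part of [D] other than [X] contains no edge of [A'], so its edges are spanned by [D :\: A']
     and lie in [F]. *)
  have eX : e \in edges_in X.
    have [Y PY eY] := parts_cl hD eD; have [<- //|nYX] := eqVneq Y X.
    case/negP: eF; apply: (subsetP (parts_edges_in_cl hD PY _) e eY).
    apply/subsetP=> g /setIP[gD gY]; rewrite inE gD andbT; apply/negP=> /(subsetP sA'X) gX.
    by have := edges_in_common gY gX; rewrite (parts_disjoint hD).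
  rewrite inE; apply/subsetP=> v ve; rewrite inE; apply/andP; split.
    by move: eX; rewrite inE => /subsetP; apply.
  apply/allP=> A As; have [_ /(_ e eX (eall A As))] := hP A As.
  by case=> [|eF']; [rewrite inE => /subsetP; apply | rewrite eF' in eF].
(* [rank_cl_edges_in] needs [Z] nonempty; if [Z] is empty, [G] is contained in [F]. *)
have [Z0|nZ] := eqVneq Z set0.
  have Z0E : edges_in Z = set0.
    apply/setP=> e; rewrite Z0 !inE subset0; apply/negP=> /eqP e0.
    by have [v] := ends_neq0 e; rewrite e0 inE.
  move: sG; rewrite Z0E setU0 => /rankS-/(_ M); rewrite rank_cl.
  by have := rankS M (subsetDl D A'); clear; lia.
have := rank_submod M (G :&: F) (edges_in Z).
have -> : G :&: F :&: edges_in Z = F :&: edges_in Z.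
  by rewrite setIAC [G :&: _]setIC (setIidPl sZG) setIC.
have := rank_cl_edges_in hD hA' (subsetDl _ _) PX sZX nZ.
have := rankS M sG; have := rank_edges_in_le a b Z; rewrite -/F rank_cl.
by clear; lia.
Qed.

(** Telescoping: each class [A] lowers the rank by [#|A| - 1], the corank of [D :\: A] in [D]. *)
Lemma rank_cl_cap D s : cyclic_set M D -> uniq s ->
  (forall A, A \in s -> series_class M D A) ->
  {in s &, forall A A' : {set edge H}, A != A' -> [disjoint A & A']} ->
  rank M (cl_cap D s) + \sum_(A <- s) #|A| = rank M D + size s.
Proof.
move=> cD; elim: s => [|A' s IH].
  move=> _ _ _; rewrite big_nil !addn0 -[RHS]rank_cl; congr rank.
  by apply/setP=> e; rewrite inE andbT.
rewrite cons_uniq => /andP[nA' us] hs ds; rewrite big_cons.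
have sub A : A \in s -> A \in A' :: s by rewrite inE orbC => ->.
have sA' := hs A' (mem_head _ _); have [_ _ _ cA' _] := sA'.
have {}IH := IH us (fun A As => hs A (sub A As)) (sub_in2 sub ds).
have := @rank_cl_cap_cons D s A' cD sA'.
suff h A : A \in s -> series_class M D A /\ [disjoint A & A'].
  move=> /(_ h); move: IH cA'; have arith (x y z r c t m : nat) :
    x + t = r + m -> z + c = r.+1 -> y + r = x + z -> y + (c + t) = r + m.+1 by lia.
  exact: arith.
move=> As; split; first exact: hs (sub A As).
by apply: ds; rewrite ?mem_head ?sub //; apply: contraNneq nA' => <-.
Qed.

(** The classes partition [D], so their sizes sum to [rank M D + k]; cancelling [rank M D] in
    [rank_cl_cap] leaves the balance equation. *)
Lemma full_count_balanced k D : 0 < k -> kfold_circuit M k D -> balanced M k D.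
Proof.
move=> k_gt0 kD; have /andP[cD /eqP eD] := kD.
set pp := principal_partition M k D.
have hpp A : A \in pp -> series_class M D A by apply: principal_partition_series.
have tpp := principal_partition_trivIset k_gt0 kD; rewrite -/pp in tpp.
(* One class is enough to place the intersection of the closures inside [cl M D]. *)
have [A0 A0pp] : exists A, A \in pp.
  have /card_gt0P[e] : 0 < #|D| by rewrite -eD; move: k_gt0; clear; lia.
  rewrite -(cover_principal_partition k_gt0 kD) => /bigcupP[A]; by exists A.
have hs A : A \in enum pp -> series_class M D A by rewrite mem_enum => /hpp.
have ds : {in enum pp &, forall A A' : {set edge H}, A != A' -> [disjoint A & A']}.
  by move=> A A'; rewrite !mem_enum; apply: (trivIsetP tpp).
have := rank_cl_cap cD (enum_uniq _) hs ds.
have -> : cl_cap D (enum pp) = \bigcap_(A in pp) cl M (D :\: A).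
  apply/setP=> e; rewrite inE; apply/andP/bigcapP => [[_ /allP h] A As | h].
    by apply: h; rewrite mem_enum.
  split; first by apply: (subsetP (clS M (subsetDl D A0))); apply: h.
  by apply/allP=> A; rewrite mem_enum; apply: h.
rewrite big_enum -cardE; move/eqP: (tpp) => ->.
rewrite cover_principal_partition // -eD.
by rewrite addnCA => /addnI.
Qed.

End FullCount.

Theorem mainTheorem5 (a b n k : nat) (hb : 1 <= b) (hba : b <= a)
    (hn : 0 < n) (hk : 1 <= k) :
  kfold_circuit_property (full_count_matroid a b n) k.
Proof. by move=> D kD; apply: full_count_balanced. Qed.
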